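(* For every rational number $\alpha\in\mathbb{Q}\cap(0,1)$, $$v(\phi(ir(\alpha)))=\overline{v(\phi(\alpha))}.$$
   Context: Notation. $\Lambda=\mathbb{Z}[A,A^{-1}]$, $\delta=-A^2-A^{-2}$, and $\Lambda^2=\Lambda[\infty]\oplus\Lambda[0]$ is the free $\Lambda$-module with basis $[\infty],[0]$. The map $v:\Lambda^2\to\Lambda$ is $v(a[\infty]+b[0])=a\delta+b$. The bar $\overline{(\cdot)}:\Lambda\to\Lambda$ is the ring involution exchanging $A$ and $A^{-1}$. The operation $ir$ on rationals. Each $\alpha\in\mathbb{Q}\cap(0,1)$ has a unique continued fraction expansion $\alpha=[0;a_1,a_2,\ldots,a_n]=\cfrac{1}{a_1+\cfrac{1}{\ddots+\cfrac1{a_n}}}$ with $n$ even and $a_1,\ldots,a_n$ positive integers; put $ir(\alpha):=[0;a_n,a_{n-1},\ldots,a_1]$. Farey sums. Irreducible fractions have non-negative denominator, with $0=\frac01$, $\infty=\frac10$. Fractions $\frac pq,\frac rs$ (listed in ascending order) are Farey neighbors if $qr-ps=1$; their Farey sum is $\frac pq\sharp\frac rs=\frac{p+r}{q+s}$. Each positive rational $\alpha$ is $y\sharp z$ for a unique pair $(y,z)$ of Farey neighbors, called the pair of parents of $\alpha$. Ancestor triangle. Let $\alpha$ be a positive rational. Put $(y_1,z_1)=(\frac01,\frac10)$ and $m_i=y_i\sharp z_i$. If $m_i=\alpha$ stop and put $N=i$; otherwise $(y_{i+1},z_{i+1})=(m_i,z_i)$ if $\alpha>m_i$ and $(y_i,m_i)$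 if $\alpha<m_i$. The ancestor triangle of $\alpha$ is the planar triangle with upper left corner $\frac01$, upper right corner $\frac10$ and bottom corner $\alpha$, decomposed into the $N$ fundamental triangles with vertices $y_i$ (upper left), $z_i$ (upper right), $m_i$ (bottom), $i=1,\ldots,N$, the $(i+1)$-st glued below the $i$-th along the edge $y_{i+1}z_{i+1}$. Its left oblique side is the chain of edges through the distinct $y_i$'s from $\frac01$ down to $\alpha$, and its right oblique side is the chain of edges through the distinct $z_i$'s from $\frac10$ down to $\alpha$; $l(\alpha)$, $r(\alpha)$ are the numbers of edges on the left and right oblique sides. For $\ast\in\{0,\infty\}$, $P_\ast(\alpha)$ is the set of descending paths from $\ast$ to $\alpha$, i.e. edge paths in the ancestor triangle in which each step goes from a vertex to a vertex of which it is a parent. Such a path $\gamma$ cuts the ancestor triangle into a left and a right part; $w_L(\gamma)$, $w_R(\gamma)$ are the numbers of fundamental triangles on the left and on the right of $\gamma$. The map $\phi$ from the non-negative rationals together with $\infty$ to $\Lambda^2$ is defined by $\phi(\infty)=A^6[\infty]$, $\phi(0)=[0]$ and, for rational $\alpha>0$, $$\phi(\alpha)=\Bigl(A^6(-A^4)^{-r(\alpha)}\sum_{\gamma\in P_\infty(\alpha)}(-A^4)^{w_R(\gamma)}\Bigr)[\infty]+\Bigl((-A^4)^{l(\alpha)}\sum_{\gamma\in P_0(\alpha)}(-A^4)^{-w_L(\gamma)}\Bigr)[0].$$ *)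

(* Defs.v *)
From HB Require Import structures.
From mathcomp Require Import all_boot all_order all_algebra finmap.
From mathcomp Require Import monalg.
From mathcomp Require Import zify ring lra.

Set Implicit Arguments.
Unset Strict Implicit.
Unset Printing Implicit Defensive.

Import Order.TTheory GRing.Theory Num.Theory.
Local Open Scope ring_scope.

(* The ring of integral Laurent polynomials, as finitely supported functions
   from int (exponents of A) to int (coefficients).  The product of monalg
   requires a monoid of exponents without nontrivial units, so the convolution
   product is defined here. *)
Definition laurent : Type := {malg int[int]}.

HB.instance Definition _ := GRing.Zmodule.on laurent.

Definition mono (k c : int) : laurent := mkmalgU k c.

Definition lmul (f g : laurent) : laurent :=
  \sum_(k <- msupp f) \sum_(l <- msupp g) mono (k + l) (f@_k * g@_l).

Section LaurentRing.

Local Open Scope fset_scope.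
Local Open Scope ring_scope.

Implicit Types f g h : laurent.

Fact monoD k : {morph mono k : c d / c + d}.
Proof. exact: monalgUD. Qed.

Fact mono0 k : mono k 0 = 0.
Proof. exact: monalgU0. Qed.

Fact lmulw (D E : {fset int}) f g : msupp f `<=` D -> msupp g `<=` E ->
  lmul f g = \sum_(k <- D) \sum_(l <- E) mono (k + l) (f@_k * g@_l).
Proof.
move=> le_D le_E; rewrite /lmul (big_fset_incl _ le_D) /=; last first.
  move=> k _ /mcoeff_outdom fk; rewrite big1 // => l _.
  by rewrite fk mul0r mono0.
apply: eq_bigr => k _; apply/big_fset_incl => // l _ /mcoeff_outdom ->.
by rewrite mulr0 mono0.
Qed.

Fact lmulC : commutative lmul.
Proof.
move=> f g; rewrite /lmul exchange_big /=; apply: eq_bigr => l _.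
by apply: eq_bigr => k _; rewrite addrC mulrC.
Qed.

Fact lmulDl : left_distributive lmul +%R.
Proof.
move=> f g h.
have le1 : msupp f `<=` msupp f `|` msupp g by exact: fsubsetUl.
have le2 : msupp g `<=` msupp f `|` msupp g by exact: fsubsetUr.
rewrite (lmulw le1 (fsubset_refl (msupp h))).
rewrite (lmulw le2 (fsubset_refl (msupp h))).
rewrite (lmulw (msuppD_le f g) (fsubset_refl (msupp h))).
rewrite -big_split; apply: eq_bigr => k _.
rewrite -big_split; apply: eq_bigr => l _ /=.
by rewrite (mcoeffD k f g) mulrDl monoD.
Qed.

Fact lmulDr : right_distributive lmul +%R.
Proof. by move=> f g h; rewrite !(lmulC f) lmulDl. Qed.

Fact lmul0l : left_zero 0 lmul.
Proof. by move=> f; rewrite /lmul msupp0 big_seq_fset0. Qed.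

Fact lmul0r : right_zero 0 lmul.
Proof. by move=> f; rewrite lmulC lmul0l. Qed.

Fact lmulUU k l c d : lmul (mono k c) (mono l d) = mono (k + l) (c * d).
Proof.
by rewrite (lmulw msuppU_le msuppU_le) !big_seq_fset1 !mcoeffUU.
Qed.

Fact laurentE f : f = \sum_(k <- msupp f) mono k f@_k.
Proof. exact: monalgE. Qed.

Fact laurent_ind (P : laurent -> Prop) :
  P 0 -> (forall f g, P f -> P g -> P (f + g)) -> (forall k c, P (mono k c)) ->
  forall f, P f.
Proof. by move=> P0 PD PU f; rewrite (laurentE f); elim/big_ind: _. Qed.

Fact lmulA : associative lmul.
Proof.
move=> f g h; elim/laurent_ind: f => [|f1 f2 IH1 IH2|k c].
- by rewrite !lmul0l.
- by rewrite !lmulDl IH1 IH2.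
elim/laurent_ind: g => [|f1 f2 IH1 IH2|l d].
- by rewrite !(lmul0l, lmul0r).
- by rewrite !(lmulDl, lmulDr) IH1 IH2.
elim/laurent_ind: h => [|f1 f2 IH1 IH2|m e].
- by rewrite !lmul0r.
- by rewrite !lmulDr IH1 IH2.
by rewrite !lmulUU addrA mulrA.
Qed.

Fact lmul1 : left_id (mono 0 1) lmul.
Proof.
elim/laurent_ind => [|f1 f2 IH1 IH2|k c].
- by rewrite lmul0r.
- by rewrite lmulDr IH1 IH2.
by rewrite lmulUU add0r mul1r.
Qed.

Fact laurent1_neq0 : mono 0 1 != 0.
Proof. by rewrite monalgU_eq0 oner_eq0. Qed.

End LaurentRing.

HB.instance Definition _ :=
  GRing.Zmodule_isComNzRing.Build laurent lmulA lmulC lmul1 lmulDl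
    laurent1_neq0.

Lemma monoM k l c d : mono k c * mono l d = mono (k + l) (c * d).
Proof. exact: lmulUU. Qed.

Lemma mono01 : mono 0 1 = 1.
Proof. by []. Qed.

Lemma mcoeff_mono k c l : (mono k c)@_l = c *+ (k == l).
Proof. exact: mcoeffU. Qed.

(* The involution exchanging A and A^-1. *)
Definition bar (f : laurent) : laurent := \sum_(k <- msupp f) mono (- k) f@_k.

Section Bar.

Local Open Scope fset_scope.
Local Open Scope ring_scope.

Implicit Types f g : laurent.

Fact barw (D : {fset int}) f : msupp f `<=` D ->
  bar f = \sum_(k <- D) mono (- k) f@_k.
Proof.
move=> le_D; rewrite /bar (big_fset_incl _ le_D) //= => k _ /mcoeff_outdom ->.
by rewrite mono0.
Qed.

Lemma bar_mono k c : bar (mono k c) = mono (- k) c.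
Proof. by rewrite (barw msuppU_le) big_seq_fset1 mcoeffUU. Qed.

Fact barD : {morph bar : f g / f + g}.
Proof.
move=> f g.
have le1 : msupp f `<=` msupp f `|` msupp g by exact: fsubsetUl.
have le2 : msupp g `<=` msupp f `|` msupp g by exact: fsubsetUr.
rewrite (barw le1) (barw le2) (barw (msuppD_le f g)) -big_split.
by apply: eq_bigr => k _ /=; rewrite (mcoeffD k f g) monoD.
Qed.

Fact bar0 : bar 0 = 0.
Proof. by rewrite /bar msupp0 big_seq_fset0. Qed.

Lemma barK : involutive bar.
Proof.
elim/laurent_ind => [|f1 f2 IH1 IH2|k c]; first by rewrite !bar0.
  by rewrite !barD IH1 IH2.
by rewrite !bar_mono opprK.
Qed.

Fact bar_is_zmod_morphism : zmod_morphism bar.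
Proof.
move=> f g; rewrite barD; congr (_ + _).
by apply/eqP; rewrite -addr_eq0 -barD addNr bar0.
Qed.

Fact bar_is_monoid_morphism : monoid_morphism bar.
Proof.
split; first by rewrite -mono01 bar_mono oppr0.
move=> f g; elim/laurent_ind: f => [|f1 f2 IH1 IH2|k c].
- by rewrite !(mul0r, bar0).
- by rewrite !(mulrDl, barD) IH1 IH2.
elim/laurent_ind: g => [|g1 g2 IH1 IH2|l d].
- by rewrite !(mulr0, bar0).
- by rewrite !(mulrDr, barD) IH1 IH2.
by rewrite monoM !bar_mono monoM opprD.
Qed.

End Bar.

HB.instance Definition _ :=
  GRing.isZmodMorphism.Build laurent laurent bar bar_is_zmod_morphism.
HB.instance Definition _ :=
  GRing.isMonoidMorphism.Build laurent laurent bar bar_is_monoid_morphism.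

Lemma mcoeff_bar f k : (bar f)@_k = f@_(- k).
Proof.
elim/laurent_ind: f => [|f1 f2 IH1 IH2|l c].
- by rewrite bar0 !mcoeff0.
- rewrite barD (mcoeffD k (bar f1) (bar f2)) IH1 IH2.
  by rewrite (mcoeffD (- k) f1 f2).
by rewrite bar_mono !mcoeff_mono eqr_oppLR.
Qed.

(* The units are the signed powers of A; this gives access to A^-1. *)
Definition lunit : {pred laurent} := [pred f |
  [exists i : 'I_(size (msupp f)), let k := nth 0 (msupp f) i in
     (f@_k \is a GRing.unit) && (f == mono k f@_k)]].

Definition linv (f : laurent) : laurent :=
  if f \in lunit then
    let k := nth 0 (msupp f) 0 in mono (- k) (f@_k)^-1 else f.

Section LaurentUnit.

Implicit Types f g : laurent.

Fact lunitP f : reflect (exists k c, c \is a GRing.unit /\ f = mono k c)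
  (f \in lunit).
Proof.
apply: (iffP existsP) => [[i /andP[u /eqP e]]|[k [c [cu ->]]]].
  by exists (nth 0 (msupp f) i), (f@_(nth 0 (msupp f) i)).
have c0 : c != 0 by apply: contraTneq cu => ->; rewrite unitr0.
have E : msupp (mono k c) = [fset k]%fset by rewrite msuppU (negPf c0).
have lt0 : (0 < size (msupp (mono k c)))%N by rewrite E cardfs1.
exists (Ordinal lt0) => /=.
have -> : nth 0 (msupp (mono k c)) 0 = k.
  by apply/eqP; rewrite -in_fset1 -E mem_nth.
by rewrite mcoeffUU cu eqxx.
Qed.

Fact linv_mono k c : c \is a GRing.unit -> linv (mono k c) = mono (- k) c^-1.
Proof.
move=> cu; have u : mono k c \in lunit by apply/lunitP; exists k, c.
have c0 : c != 0 by apply: contraTneq cu => ->; rewrite unitr0.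
have E : msupp (mono k c) = [fset k]%fset by rewrite msuppU (negPf c0).
have lt0 : (0 < size (msupp (mono k c)))%N by rewrite E cardfs1.
rewrite /linv u /=.
have -> : nth 0 (msupp (mono k c)) 0 = k.
  by apply/eqP; rewrite -in_fset1 -E mem_nth.
by rewrite mcoeffUU.
Qed.

Fact lmulVr : {in lunit, left_inverse 1 linv *%R}.
Proof.
move=> f /lunitP[k [c [cu ->]]].
by rewrite linv_mono // monoM addNr mulVr.
Qed.

Fact linv_out : {in [predC lunit], linv =1 id}.
Proof. by move=> f; rewrite inE /= /linv => /negPf ->. Qed.

Fact seq_max (s : seq int) : s != [::] ->
  exists2 k, k \in s & {in s, forall l, l <= k}.
Proof.
elim: s => // x [|y s] IH _.
  by exists x; rewrite ?mem_head // => l; rewrite inE => /eqP ->.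
have [//|k ks kmax] := IH; have [xk|kx] := lerP x k.
  exists k; first by rewrite inE ks orbT.
  by move=> l; rewrite inE => /orP[/eqP -> //|/kmax].
exists x; first exact: mem_head.
move=> l; rewrite inE => /orP[/eqP -> //|/kmax lk].
exact: le_trans lk (ltW kx).
Qed.

Fact lead_mono f : f != 0 ->
  exists2 k : int, f@_k != 0 & forall l : int, f@_l != 0 -> l <= k.
Proof.
move=> f0; have [|k ks kmax] := @seq_max (msupp f).
  apply: contra_neq f0 => e; apply/malgP => k.
  rewrite mcoeff0 mcoeff_outdom //.
  by have -> : (k \in msupp f) = (k \in enum_fset (msupp f)) by []; rewrite e.
exists k; first by rewrite mcoeff_neq0.
by move=> l; rewrite mcoeff_neq0 => /kmax.
Qed.

Fact mcoeffM_lead f g (k l : int) :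
  (forall i, f@_i != 0 -> i <= k) -> (forall j, g@_j != 0 -> j <= l) ->
  (f * g)@_(k + l) = f@_k * g@_l.
Proof.
move=> fk gl; have [F|/mcoeff_outdom F] := boolP (k \in msupp f); last first.
  rewrite F mul0r [f * g]/(lmul f g) /lmul raddf_sum big_seq big1 // => i.
  rewrite -mcoeff_neq0 => fi0; rewrite raddf_sum big_seq big1 // => j.
  rewrite -mcoeff_neq0 => gj0; rewrite /= mcoeff_mono.
  case: eqP => // e; have fi := fk _ fi0; have gj := gl _ gj0.
  have ik : i = k by lia.
  by rewrite ik F eqxx in fi0.
have [G|/mcoeff_outdom G] := boolP (l \in msupp g); last first.
  rewrite G mulr0 [f * g]/(lmul f g) /lmul raddf_sum big_seq big1 // => i.
  rewrite -mcoeff_neq0 => fi0; rewrite raddf_sum big_seq big1 // => j.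
  rewrite -mcoeff_neq0 => gj0; rewrite /= mcoeff_mono.
  case: eqP => // e; have fi := fk _ fi0; have gj := gl _ gj0.
  have jl : j = l by lia.
  by rewrite jl G eqxx in gj0.
rewrite [f * g]/(lmul f g) /lmul raddf_sum (big_fsetD1 k) //= raddf_sum.
rewrite (big_fsetD1 l) //= mcoeff_mono eqxx.
rewrite big1_fset ?addr0 => [|j]; last first.
  rewrite in_fsetD1 => /andP[/eqP jl _] _; rewrite mcoeff_mono.
  by case: eqP => // /addrI.
rewrite big1_fset ?addr0 // => i.
rewrite in_fsetD1 => /andP[/eqP ik fi] _; rewrite raddf_sum big_seq big1 // => j.
move: fi; rewrite -!mcoeff_neq0 => /fk fi /gl gj; rewrite /= mcoeff_mono.
by case: eqP => // e; case: ik; lia.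
Qed.

Fact lunitPl f g : g * f = 1 -> f \in lunit.
Proof.
move=> gf1.
have f0 : f != 0 by apply: contra_eq_neq gf1 => ->; rewrite mulr0 eq_sym oner_neq0.
have g0 : g != 0 by apply: contra_eq_neq gf1 => ->; rewrite mul0r eq_sym oner_neq0.
have bar_neq0 h : h != 0 -> bar h != 0.
  by apply: contra_neq => e; rewrite -[h]barK e bar0.
have coef1 n : (1 : laurent)@_n = (0 == n)%:R by rewrite -mono01 mcoeff_mono.
have [k fk kmax] := lead_mono f0; have [l gl lmax] := lead_mono g0.
have [k' fk' kmax'] := lead_mono (bar_neq0 _ f0).
have [l' gl' lmax'] := lead_mono (bar_neq0 _ g0).
have E1 := mcoeffM_lead lmax kmax.
have E2 := mcoeffM_lead lmax' kmax'.
rewrite gf1 coef1 in E1; rewrite -rmorphM gf1 rmorph1 coef1 in E2.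
have kl : 0 = l + k.
  apply/eqP; case: (0 =P l + k) E1 => // _ /esym/eqP.
  by rewrite mulf_eq0 (negPf fk) (negPf gl).
have kl' : 0 = l' + k'.
  apply/eqP; case: (0 =P l' + k') E2 => // _ /esym/eqP.
  by rewrite mulf_eq0 (negPf fk') (negPf gl').
rewrite !mcoeff_bar in fk' gl'.
have h1 := kmax _ fk'; have h2 := lmax _ gl'.
have ek : k' = - k by lia.
apply/lunitP; exists k, (f@_k); split.
  by apply/unitrP; exists (g@_l); rewrite [f@_k * _]mulrC -E1 -kl eqxx.
apply/malgP => n; rewrite mcoeff_mono; case: eqP => [-> //|kn].
apply/eqP; apply/negPn/negP => fn.
have h3 := kmax _ fn.
have h4 : - n <= k' by apply: kmax'; rewrite mcoeff_bar opprK.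
by apply: kn; lia.
Qed.

End LaurentUnit.

HB.instance Definition _ :=
  GRing.ComNzRing_hasMulInverse.Build laurent lmulVr lunitPl linv_out.

Definition A : laurent := mono 1 1.

Lemma A_unit : A \is a GRing.unit.
Proof. by apply/lunitP; exists 1, 1; rewrite unitr1. Qed.

Lemma invA : A^-1 = mono (-1) 1.
Proof. by rewrite /A [LHS]linv_mono ?unitr1 // invr1. Qed.

Lemma barA : bar A = A^-1.
Proof. by rewrite invA bar_mono. Qed.

Definition delta : laurent := - A ^+ 2 - A ^- 2.

Definition laurent2 : Type := (laurent^o * laurent^o)%type.

HB.instance Definition _ := GRing.Lmodule.on laurent2.

Definition basis_inf : laurent2 := (1, 0).
Definition basis_0 : laurent2 := (0, 1).

Definition v (x : laurent2) : laurent := x.1 * delta + x.2.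

Lemma v_basis (a b : laurent) :
  v (a *: basis_inf + b *: basis_0) = a * delta + b.
Proof.
rewrite /v; have -> : a *: basis_inf + b *: basis_0 =
  (a * 1 + b * 0, a * 0 + b * 1) :> laurent2 by [].
by rewrite /= !(mulr0, mulr1) addr0 add0r.
Qed.

(* Continued fractions: cf [:: a1; ...; an] = [0; a1, ..., an]. *)
Fixpoint cf (s : seq nat) : rat :=
  if s is a :: s' then (a%:R + cf s')^-1 else 0.

Definition is_even_cf (a : rat) (s : seq nat) : bool :=
  [&& all (leq 1) s, ~~ odd (size s) & cf s == a].

Section ContinuedFractions.

Fact cf_exists (p q : nat) (e : bool) : (0 < p < q)%N ->
  exists s, [/\ all (leq 1) s, odd (size s) = e & cf s = p%:R / q%:R].
Proof.
elim/ltn_ind: p q e => p IH q e /andP[p0 pq].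
have eq_q := divn_eq q p; set d := (q %/ p)%N in eq_q; set r := (q %% p)%N in eq_q.
have lt_r : (r < p)%N by rewrite ltn_mod.
have d0 : (0 < d)%N by rewrite divn_gt0 // ltnW.
have pN0 : (p%:R : rat) != 0 by rewrite pnatr_eq0 -lt0n.
have dN0 : (d%:R : rat) != 0 by rewrite pnatr_eq0 -lt0n.
have [r0|rpos] := posnP r.
  have eq_q' : (q%:R : rat) = d%:R * p%:R by rewrite eq_q r0 addn0 natrM.
  have d2 : (1 < d)%N by rewrite r0 in eq_q; nia.
  case: e.
    exists [:: d]; split=> //=; first by rewrite d0.
    by rewrite eq_q' addr0; field; rewrite pN0 dN0.
  exists [:: d.-1; 1%N]; split=> //=; first by rewrite -ltnS prednK ?d2 // .
  rewrite addr0 invr1 -[X in _ + X]/(1%:R) -natrD addn1 prednK // eq_q'.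
  by field; rewrite pN0 dN0.
have [||s [s_pos s_par s_cf]] := IH r _ p (~~ e); rewrite ?rpos //.
exists (d :: s); split=> /=; first by rewrite d0.
  by rewrite s_par negbK.
have q0 : (q%:R : rat) != 0 by rewrite pnatr_eq0 -lt0n; lia.
have eq_q' : (q%:R : rat) = d%:R * p%:R + r%:R by rewrite eq_q natrD natrM.
rewrite s_cf -[RHS]invf_div; congr (_^-1).
by rewrite eq_q' mulrDl mulfK.
Qed.

Fact even_cf_exists (a : rat) : exists s, (0 < a < 1) ==> is_even_cf a s.
Proof.
have [/andP[a0 a1]|_] := boolP (0 < a < 1); last by exists [::].
have n0 : 0 < numq a by rewrite numq_gt0.
have an : a = (`|numq a|%N)%:R / (`|denq a|%N)%:R.
  rewrite -[LHS]divq_num_den !pmulrn (gez0_abs (ltW n0)).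
  by rewrite (gez0_abs (denq_ge0 a)).
have [|s [s_pos s_par s_cf]] := @cf_exists `|numq a|%N `|denq a|%N false.
  have d0 := denq_gt0 a.
  suff : numq a < denq a by lia.
  rewrite -(ltr_int rat) -[ltRHS]mul1r -ltr_pdivrMr ?ltr0z //.
  by rewrite divq_num_den.
by exists s; rewrite implyTb /is_even_cf s_pos s_par s_cf -an eqxx.
Qed.

Fact cf_ge0 s : 0 <= cf s.
Proof. by elim: s => //= a s IH; rewrite invr_ge0 addr_ge0. Qed.

Fact cf_gt0 s : all (leq 1) s -> s != [::] -> 0 < cf s.
Proof.
case: s => //= a s /andP[a1 _] _; rewrite invr_gt0.
by rewrite ltr_wpDr ?cf_ge0 // ltr0n.
Qed.

Fact cf_lt1 s : all (leq 1) s -> s != [:: 1%N] -> cf s < 1.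
Proof.
case: s => [|a s] //= /andP[a1 s1] ns1.
rewrite invf_lt1; last by rewrite ltr_wpDr ?cf_ge0 // ltr0n.
case: s s1 ns1 => [_|b s s1 _].
  rewrite addr0 ltr1n; case: a a1 => [|[|a]] //.
rewrite ltr_pwDr ?ler1n //; exact: cf_gt0.
Qed.

Fact natr_frac_inj (a b : nat) (x y : rat) :
  0 <= x < 1 -> 0 <= y < 1 -> a%:R + x = b%:R + y -> a = b /\ x = y.
Proof.
move=> /andP[x0 x1] /andP[y0 y1] e.
have ab : a = b.
  apply/eqP; rewrite eqn_leq -(ltnS a) -(ltnS b) -!(ltr_nat rat) -!natr1.
  by apply/andP; split; lra.
by split=> //; move: e; rewrite ab => /addrI.
Qed.

Lemma cf_unique s t : all (leq 1) s -> all (leq 1) t ->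
  odd (size s) = odd (size t) -> cf s = cf t -> s = t.
Proof.
elim: s t => [|a s IH] [|b t] // s1 t1 par e.
- by have := cf_gt0 t1 isT; rewrite -e ltxx.
- by have := cf_gt0 s1 isT; rewrite e ltxx.
move: e s1 t1 par => /= /invr_inj e /andP[a1 s1] /andP[b1 t1] /negb_inj par.
have [es|ns] := eqVneq s [:: 1%N]; have [et|nt] := eqVneq t [:: 1%N].
- move: e; rewrite es et => /addIr /eqP; rewrite eqr_nat => /eqP ->.
  by [].
- have ct : 0 <= cf t < 1 by rewrite cf_ge0 cf_lt1.
  have [] := @natr_frac_inj a.+1 b 0 (cf t) _ ct.
  + by rewrite lexx ltr01.
  + by rewrite addr0 -e es /= addr0 invr1 -natr1.
  move=> _ ct0; case: t t1 {IH nt ct e} ct0 par => [|c t] t1 ct0 par.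
    by rewrite es in par.
  by have := cf_gt0 t1 isT; rewrite -ct0 ltxx.
- have cs : 0 <= cf s < 1 by rewrite cf_ge0 cf_lt1.
  have [] := @natr_frac_inj b.+1 a 0 (cf s) _ cs.
  + by rewrite lexx ltr01.
  + by rewrite addr0 e et /= addr0 invr1 -natr1.
  move=> _ cs0; case: s s1 {IH ns cs e} cs0 par => [|c s] s1 cs0 par.
    by rewrite et in par.
  by have := cf_gt0 s1 isT; rewrite -cs0 ltxx.
have [||-> e'] := @natr_frac_inj a b (cf s) (cf t) _ _ e.
- by rewrite cf_ge0 cf_lt1.
- by rewrite cf_ge0 cf_lt1.
by rewrite (IH t).
Qed.

End ContinuedFractions.

(* The expansion of even length; meaningful for 0 < a < 1. *)
Definition even_cf (a : rat) : seq nat := xchoose (even_cf_exists a).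

Lemma even_cfP a : 0 < a < 1 -> is_even_cf a (even_cf a).
Proof. by apply/implyP; exact: (xchooseP (even_cf_exists a)). Qed.

Lemma even_cf_unique a s : 0 < a < 1 -> is_even_cf a s -> s = even_cf a.
Proof.
move=> /even_cfP /and3P[t1 tpar /eqP tcf] /and3P[s1 spar /eqP scf].
by apply: cf_unique; rewrite ?scf ?tcf ?(negPf tpar) ?(negPf spar).
Qed.

Definition ir (a : rat) : rat := cf (rev (even_cf a)).

(* The rationals together with infinity = None. *)
Definition qinf : Type := option rat.

HB.instance Definition _ := Countable.on qinf.

Definition rat_qinf (a : rat) : qinf := Some a.
Coercion rat_qinf : rat >-> qinf.

Definition infty : qinf := None.
Definition zero : qinf := rat_qinf 0.

(* Irreducible numerator and denominator, with infinity = 1/0. *)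
Definition qnum (x : qinf) : int := if x is Some a then numq a else 1.
Definition qden (x : qinf) : int := if x is Some a then denq a else 0.

Definition frac (p q : int) : qinf :=
  if q == 0 then infty else (p%:~R / q%:~R : rat).

Definition qlt (x y : qinf) : bool := qnum x * qden y < qnum y * qden x.

Definition farey_neighbors (x y : qinf) : bool :=
  qden x * qnum y - qnum x * qden y == 1.

Definition farey_sum (x y : qinf) : qinf :=
  frac (qnum x + qnum y) (qden x + qden y).

Definition is_parents (y z w : qinf) : bool :=
  [&& qlt zero w, farey_neighbors y z & farey_sum y z == w].

(* The i-th pair (y, z), counting from 0.  The recursion goes on after
   farey_sum y z = a has been reached; only the indices i < ntri a are used. *)
Definition step (a : rat) (yz : qinf * qinf) : qinf * qinf :=
  let m := farey_sum yz.1 yz.2 in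
  if qlt m a then (m, yz.2) else (yz.1, m).

Definition yz (a : rat) (i : nat) : qinf * qinf :=
  iter i (step a) (zero, infty).

Definition ytri (a : rat) (i : nat) : qinf := (yz a i).1.
Definition ztri (a : rat) (i : nat) : qinf := (yz a i).2.
Definition mtri (a : rat) (i : nat) : qinf := farey_sum (ytri a i) (ztri a i).

Section Farey.

Implicit Types (a : rat) (x y z w : qinf).

Fact qden_ge0 x : 0 <= qden x.
Proof. by case: x => //= a; exact: denq_ge0. Qed.

Fact qinfP x y : qnum x = qnum y -> qden x = qden y -> x = y.
Proof.
case: x y => [a|] [b|] //= n d.
- by congr Some; rewrite -[a]divq_num_den -[b]divq_num_den n d.
- by have := denq_neq0 a; rewrite d.
- by have := denq_neq0 b; rewrite -d.
Qed.

Fact farey_sumE y z : farey_neighbors y z ->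
  qnum (farey_sum y z) = qnum y + qnum z /\
  qden (farey_sum y z) = qden y + qden z.
Proof.
rewrite /farey_neighbors /farey_sum /frac => /eqP.
have := qden_ge0 y; have := qden_ge0 z.
set p := qnum y; set q := qden y; set r := qnum z; set s := qden z.
move=> s0 q0 det; have qs0 : q + s != 0.
  apply: contra_eqN det => /eqP qs.
  have q00 : q = 0 by lia.
  have s00 : s = 0 by lia.
  by rewrite q00 s00 mul0r mulr0.
rewrite (negPf qs0).
have qs : 0 < q + s by lia.
have cop : coprimez (p + r) (q + s).
  by apply/coprimezP; exists (q, - p) => /=; rewrite -det; ring.
rewrite /= coprimeq_num // gtr0_sg // mul1r; split=> //.
by rewrite coprimeq_den // (negPf qs0) gtr0_norm.
Qed.

Fact qlt_rat (a b : rat) : qlt a b = (a < b).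
Proof.
rewrite /qlt /= -(ltr_int rat) !intrM.
rewrite -[in RHS](divq_num_den a) -[in RHS](divq_num_den b).
by rewrite ltr_pdivrMr ?ltr0z // mulrAC ltr_pdivlMr ?ltr0z.
Qed.

Fact descent_inv a i : 0 < a -> (forall j, (j < i)%N -> mtri a j != a :> qinf) ->
  [/\ farey_neighbors (ytri a i) (ztri a i), 0 <= qnum (ytri a i),
      0 <= qnum (ztri a i), qlt (ytri a i) a & qlt a (ztri a i)] /\
  i%:Z + 2 <= qnum (ytri a i) + qden (ytri a i) +
              (qnum (ztri a i) + qden (ztri a i)).
Proof.
move=> a0; elim: i => [_|i IH ne].
  split; [split=> // | by []]; last by rewrite /qlt /= mulr0 mul1r denq_gt0.
  by rewrite (qlt_rat 0 a).
have [[det y0 z0 ya az] sz] := IH (fun j ji => ne j (ltnW ji)).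
have [mn md] := farey_sumE det.
have nem := ne i (ltnSn i).
rewrite /ytri /ztri /yz iterS -/(yz a i) /step -/(ytri a i) -/(ztri a i).
rewrite -/(mtri a i); rewrite -!/(mtri a i) in mn md.
move: det; rewrite /farey_neighbors => /eqP det.
have := qden_ge0 (ytri a i); have := qden_ge0 (ztri a i) => qz qy.
case: ifP => [ma|nma] /=.
  split; last by rewrite mn md; nia.
  by split=> //; rewrite ?mn ?md; [apply/eqP; rewrite -det; ring | lia].
have am : qlt a (mtri a i).
  move: nma nem; case: (mtri a i) mn md => [m|]; last first.
    by move=> _ _ _ _; rewrite /qlt /= mulr0 mul1r denq_gt0.
  move=> _ _; rewrite !qlt_rat => nma nem.
  rewrite lt_neqAle leNgt nma andbT eq_sym.
  by apply: contraNneq nem => ->.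
split; last by rewrite mn md; nia.
by split=> //; rewrite ?mn ?md; [apply/eqP; rewrite -det; ring | lia].
Qed.

Fact descent_stops a : exists i, (0 < a) ==> (mtri a i == a :> qinf).
Proof.
have [a0|_] := boolP (0 < a); last by exists 0%N.
pose n := absz (numq a + denq a).
have [/existsP[i e]|ne] := boolP [exists i : 'I_n, mtri a i == a :> qinf].
  by exists i; rewrite e.
have [j jn|] := @descent_inv a n a0.
  by rewrite negb_exists in ne; have := forallP ne (Ordinal jn).
case; rewrite /farey_neighbors /qlt /= => /eqP det y0 z0 ya az sz.
have n0 : 0 < numq a by rewrite numq_gt0.
have d0 := denq_gt0 a.
have en : n%:Z = numq a + denq a by rewrite /n; lia.
move: det y0 z0 ya az sz; rewrite en.
have := qden_ge0 (ytri a n); have := qden_ge0 (ztri a n).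
move: (qnum (ytri a n)) (qden (ytri a n)) (qnum (ztri a n)) (qden (ztri a n)).
move: (numq a) (denq a) n0 d0 => b c b0 c0 p q r s s0 q0 det p0 r0 ya az sz.
have u1 : 1 <= b * q - p * c by lia.
have v1 : 1 <= r * c - b * s by lia.
have eb : b = (r * c - b * s) * p + (b * q - p * c) * r.
  by rewrite -[LHS]mulr1 -det; ring.
have ec : c = (r * c - b * s) * q + (b * q - p * c) * s.
  by rewrite -[LHS]mulr1 -det; ring.
have : p + r <= b by rewrite eb; apply: lerD; rewrite ler_peMl.
have : q + s <= c by rewrite ec; apply: lerD; rewrite ler_peMl.
lia.
Qed.

End Farey.

Definition ntri (a : rat) : nat := (ex_minn (descent_stops a)).+1.

Lemma mtri_last a : 0 < a -> mtri a (ntri a).-1 = a :> qinf.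
Proof. by rewrite /ntri; case: ex_minnP => i /implyP h _ /h /eqP. Qed.

Lemma mtri_neq a i : 0 < a -> (i < (ntri a).-1)%N -> mtri a i != a :> qinf.
Proof.
rewrite /ntri; case: ex_minnP => n _ nmin a0 /= lt_in.
by apply: contraTN lt_in => e; rewrite -leqNgt nmin // e implybT.
Qed.

(* The ancestor triangle: the fundamental triangles are indexed by i < ntri a. *)
Definition triangle (a : rat) (i : nat) : seq qinf :=
  [:: ytri a i; ztri a i; mtri a i].

Definition vertices (a : rat) : seq qinf :=
  undup (flatten [seq triangle a i | i <- iota 0 (ntri a)]).

Definition edge (a : rat) (u w : qinf) : bool :=
  has (fun i => [&& u != w, u \in triangle a i & w \in triangle a i])
      (iota 0 (ntri a)).

Definition left_side (a : rat) : seq qinf :=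
  rcons (undup [seq ytri a i | i <- iota 0 (ntri a)]) (rat_qinf a).

Definition right_side (a : rat) : seq qinf :=
  rcons (undup [seq ztri a i | i <- iota 0 (ntri a)]) (rat_qinf a).

Definition l (a : rat) : nat := (size (left_side a)).-1.
Definition r (a : rat) : nat := (size (right_side a)).-1.

(* The only candidate for the other parent is the Farey difference of w and u,
   see is_parentP. *)
Definition is_parent (u w : qinf) : bool :=
  let z := frac (qnum w - qnum u) (qden w - qden u) in
  is_parents u z w || is_parents z u w.

Lemma is_parentP u w :
  reflect (exists z, is_parents u z w \/ is_parents z u w) (is_parent u w).
Proof.
have fracE z : frac (qnum z) (qden z) = z.
  by case: z => [b|] //=; rewrite /frac denq_eq0 divq_num_den.
apply: (iffP orP) => [h|[z h]]; first by eexists; exact: h.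
suff -> : frac (qnum w - qnum u) (qden w - qden u) = z by [].
have {h} [-> ->] : qnum w = qnum u + qnum z /\ qden w = qden u + qden z.
  case: h => /and3P[_ det /eqP <-]; have [-> ->] := farey_sumE det => //.
  by split; rewrite addrC.
by rewrite [qnum u + _]addrC [qden u + _]addrC !addrK fracE.
Qed.

Definition descent (a : rat) (u w : qinf) : bool := edge a u w && is_parent u w.

Fixpoint words (T : Type) (n : nat) (s : seq T) : seq (seq T) :=
  if n is n'.+1 then [seq x :: p | x <- s, p <- words n' s] else [:: [::]].

Definition vertex_seqs (s : qinf) (a : rat) : seq (seq qinf) :=
  [seq s :: p | n <- iota 0 (size (vertices a)).+1, p <- words n (vertices a)].

(* Descending paths from s to a, as sequences of vertices; bounding their length
   by the number of vertices loses nothing, see pathsP. *)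
Definition paths (s : qinf) (a : rat) : {fset seq qinf} :=
  [fset g in vertex_seqs s a |
     path (descent a) s (behead g) && (last s (behead g) == a :> qinf)]%fset.

Section Paths.

Fact wordsP (T : eqType) n (s p : seq T) :
  (p \in words n s) = (size p == n) && all (mem s) p.
Proof.
elim: n p => [|n IH] [|x p] //=.
  by apply/negP => /allpairsP[[y q] [/= _ _]].
apply/allpairsP/andP => [[[y q] [/= ys qs [-> ->]]]|].
  by move: qs; rewrite IH eqSS ys => /andP[-> ->].
rewrite eqSS => -[sp /andP[xs ps]]; exists (x, p); split=> //=.
by rewrite IH sp.
Qed.

Fact edge_vertices a u w : edge a u w -> u \in vertices a /\ w \in vertices a.
Proof.
case/hasP => i iN /and3P[_ ui wi]; rewrite !mem_undup.
by split; apply/flatten_mapP; exists i.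
Qed.

Definition height (x : qinf) : nat := absz (qnum x + qden x).

Fact parents_height y z w : is_parents y z w ->
  (height y < height w)%N /\ (height z < height w)%N.
Proof.
case/and3P=> w0 det /eqP e; have [en ed] := farey_sumE det.
rewrite /height; rewrite e in en ed; move: w0 det; rewrite /qlt mul0r mulr1.
rewrite /farey_neighbors en ed => w0 /eqP.
have := qden_ge0 y; have := qden_ge0 z.
have den1 x : qden x = 0 -> qnum x = 1.
  by case: x => [b|] //= /eqP; rewrite denq_eq0.
move: (den1 y) (den1 z) w0.
move: (qnum y) (qnum z) (qden y) (qden z) => p r q s hy hz w0 s0 q0 det.
have p0 : 0 <= p.
  rewrite leNgt; apply/negP => p0.
  have [q1|q1] := eqVneq q 0; first by have := hy q1; lia.
  have q2 : 1 <= q by lia.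
  by nia.
have r0 : 0 <= r.
  rewrite leNgt; apply/negP => r0.
  by nia.
have y1 : 0 < p + q by nia.
have z1 : 0 < r + s by nia.
by lia.
Qed.

Fact descent_height a u w : descent a u w -> (height u < height w)%N.
Proof.
by case/andP=> _ /is_parentP[z [/parents_height[]|/parents_height[]]].
Qed.

Lemma pathsP s a g :
  reflect (exists p, [/\ g = s :: p, path (descent a) s p & last s p = a :> qinf])
    (g \in paths s a).
Proof.
apply: (iffP idP).
  rewrite inE => /andP[gs /andP[]].
  case/allpairsPdep: gs => n [p [_ _ ->]] /= sp /eqP lp.
  by exists p.
case=> p [-> sp lp]; rewrite inE; apply/andP; split; last by rewrite /= sp lp /=.
have pV : all (mem (vertices a)) p.
  elim: p s sp {lp} => //= w p IH s /andP[/andP[/edge_vertices[_ wV] _] wp].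
  by rewrite wV (IH w).
have sz : (size p <= size (vertices a))%N.
  apply: uniq_leq_size; last exact/allP.
  apply: (@map_uniq _ _ height); apply: (sorted_uniq ltn_trans ltnn).
  rewrite sorted_map; move/path_sorted: sp; apply: sub_sorted => u w.
  exact: descent_height.
apply/allpairsPdep; exists (size p), p; split=> //.
  by rewrite mem_iota.
by rewrite wordsP eqxx.
Qed.

End Paths.

(* All vertices of the ancestor triangle lie on its oblique sides, and the
   fundamental triangle i is the part of it just below the edge joining
   ytri a i on the left side to ztri a i on the right side.  A descending path
   has to cross this edge; it continues downwards from the last of the two
   endpoints that it visits, and the triangle is on the right of the path if
   this is the left endpoint, and on its left if it is the right one. *)
Definition exit_point (g : seq qinf) (y z : qinf) : option qinf :=
  ohead (rev [seq u <- g | (u == y) || (u == z)]).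

Definition wL (a : rat) (g : seq qinf) : nat :=
  count (fun i => exit_point g (ytri a i) (ztri a i) == Some (ztri a i))
        (iota 0 (ntri a)).

Definition wR (a : rat) (g : seq qinf) : nat :=
  count (fun i => exit_point g (ytri a i) (ztri a i) == Some (ytri a i))
        (iota 0 (ntri a)).

(* Meaningful on the non-negative rationals and infinity. *)
Definition phi (x : qinf) : laurent2 :=
  if x is Some a then
    if a == 0 then basis_0 else
      (A ^+ 6 * (- A ^+ 4) ^- r a *
         \sum_(g <- paths infty a) (- A ^+ 4) ^+ wR a g) *: basis_inf +
      ((- A ^+ 4) ^+ l a *
         \sum_(g <- paths zero a) (- A ^+ 4) ^- wL a g) *: basis_0
  else A ^+ 6 *: basis_inf.

(* Main.v *)
Require Import Defs.
From mathcomp Require Import all_boot all_order all_algebra finmap.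
From mathcomp Require Import zify ring lra.

Set Implicit Arguments.
Unset Strict Implicit.
Unset Printing Implicit Defensive.

Import Order.TTheory GRing.Theory Num.Theory.
Local Open Scope ring_scope.

(** Write q for - A ^+ 4 and p for its inverse.  The ancestor triangle of a
    is built by a word of left and right turns, one for each fundamental
    triangle but the last.  Every descending path meets the edge joining
    ytri a i to ztri a i, so the weighted sums over the paths from a fixed root
    to these two vertices form a vector, and turning left or right multiplies it
    by a 2 x 2 matrix.  The powers q ^- r a and q ^+ l a in phi turn the two
    matrix systems, one for the paths from infinity counted by wR and one for
    the paths from 0 counted by wL, into one and the same system
        X true = [q, 1; 0, 1]        X false = [1, 0; 1, p].
    Since A ^+ 6 * delta = q * (1 - q), evaluating v amounts to applying the
    product of these matrices to the vector (1, 1 - q).  For a < 1 the first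
    turn goes left, and X false sends (1, 1 - q) to u = (1, p); hence
        v (phi a) = q * (u^T P u),
    where P is the product of the X over the turns after the first (v_phi).

    The theorem follows from two symmetries of the form u^T P u.
    - Reversal.  A symmetric matrix T satisfies X d * T = T * (X d)^T for both
      d, and u is an eigenvector of T with eigenvalue - 1.  So reversing the
      order of the factors of P leaves u^T P u unchanged (form_rev), although
      P itself changes.
    - Bar.  Exchanging q with p and the two coordinates exchanges X true with
      X false, and maps u to q times itself (form_flip).
    Together they say that reversing the word and exchanging left with right
    conjugates q * (u^T P u) (form_dual).

    On the side of rationals, the turns towards [0; a1, ..., an] with n even
    are a1 times left, a2 times right, ..., an times right, with the last right
    turn omitted.  Once that turn is restored, reversing the continued fraction
    is reversing the word and exchanging left with right; the words of alpha
    and of ir alpha then have the form left :: w and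
    left :: rev (map negb w), which is what form_dual needs. *)

(** * Products of transfer matrices and their symmetries *)

Section TransferMatrices.

Variable R : comNzRingType.

Definition mx2 (a b c d : R) : 'M[R]_2 :=
  \matrix_(i, j) if i == 0 then if j == 0 then a else b
                 else if j == 0 then c else d.

Lemma mx2_eta (M : 'M[R]_2) : M = mx2 (M 0 0) (M 0 1) (M 1 0) (M 1 1).
Proof.
apply/matrixP => i j; rewrite mxE.
by case: i j => [[|[|//]] ?] [[|[|//]] ?] /=; congr (M _ _); apply: val_inj.
Qed.

Lemma mx2M a b c d a' b' c' d' : mx2 a b c d * mx2 a' b' c' d' =
  mx2 (a * a' + b * c') (a * b' + b * d') (c * a' + d * c') (c * b' + d * d').
Proof.
apply/matrixP => i j; rewrite !mxE !big_ord_recl big_ord0 !mxE addr0.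
by case: i j => [[|[|//]] ?] [[|[|//]] ?].
Qed.

Lemma mx2_mulE b c d e (M : 'M[R]_2) k :
  ((mx2 b c d e * M) 0 k = b * M 0 k + c * M 1 k) *
  ((mx2 b c d e * M) 1 k = d * M 0 k + e * M 1 k).
Proof.
have l1 : lift ord0 (ord0 : 'I_1) = 1 :> 'I_2 by exact: val_inj.
by split; rewrite !mxE !big_ord_recl big_ord0 addr0 !mxE l1.
Qed.

Lemma mx2_tr a b c d : (mx2 a b c d)^T = mx2 a c b d.
Proof.
apply/matrixP => i j; rewrite !mxE.
by case: i j => [[|[|//]] ?] [[|[|//]] ?].
Qed.

Lemma mx2Z k a b c d : k *: mx2 a b c d = mx2 (k * a) (k * b) (k * c) (k * d).
Proof.
apply/matrixP => i j; rewrite !mxE.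
by case: i j => [[|[|//]] ?] [[|[|//]] ?].
Qed.

(** How a turn acts on the pair of path sums at (ytri, ztri), when a triangle
    passed on its left side weighs s and on its right side t; true is a turn to
    the right, that is, the replacement of the left vertex. *)
Definition transfer (s t : R) (d : bool) : 'M[R]_2 :=
  if d then mx2 s t 0 t else mx2 s 0 s t.

Definition transfers (s t : R) (w : seq bool) : 'M[R]_2 :=
  \prod_(d <- rev w) transfer s t d.

Lemma transfers_rcons s t w d :
  transfers s t (rcons w d) = transfer s t d * transfers s t w.
Proof. by rewrite /transfers rev_rcons big_cons. Qed.

Lemma transfers_cons s t w d :
  transfers s t (d :: w) = transfers s t w * transfer s t d.
Proof. by rewrite /transfers rev_cons big_rcons. Qed.

Variables q p : R.
Hypothesis qp : q * p = 1.

(** The common normalization of transfer q 1 and transfer 1 p; these matrices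
    also appear in the theory of q-deformed rationals. *)
Definition qmat (d : bool) : 'M[R]_2 :=
  if d then mx2 q 1 0 1 else mx2 1 0 1 p.

Definition qmats (w : seq bool) : 'M[R]_2 := \prod_(d <- rev w) qmat d.

Lemma qmats_cons w d : qmats (d :: w) = qmats w * qmat d.
Proof. by rewrite /qmats rev_cons big_rcons. Qed.

Lemma qmats_rcons w d : qmats (rcons w d) = qmat d * qmats w.
Proof. by rewrite /qmats rev_rcons big_cons. Qed.

(** Each left turn contributes a vertex to the right oblique side, and the
    excess factor q here is what q ^- r removes. *)
Lemma transfers_q1 w : transfers q 1 w = q ^+ count negb w *: qmats w.
Proof.
elim: w => [|d w IH]; first by rewrite /transfers /qmats !big_nil scale1r.
rewrite transfers_cons qmats_cons IH /= exprD mulrC -scalerA.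
rewrite -scalerAl; congr (_ *: _); rewrite scalerAr; congr (_ * _).
case: d => /=; first by rewrite scale1r.
by rewrite mx2Z !mulr1 mulr0 qp.
Qed.

Lemma transfers_1p w : transfers 1 p w = p ^+ count id w *: qmats w.
Proof.
elim: w => [|d w IH]; first by rewrite /transfers /qmats !big_nil scale1r.
rewrite transfers_cons qmats_cons IH /= exprD mulrC -scalerA.
rewrite -scalerAl; congr (_ *: _); rewrite scalerAr; congr (_ * _).
case: d => /=; last by rewrite scale1r.
by rewrite mx2Z !mulr1 mulr0 mulrC qp.
Qed.

(** The value u^T M u at u = (1, p). *)
Definition form (M : 'M[R]_2) : R :=
  M 0 0 + p * M 0 1 + p * M 1 0 + p ^+ 2 * M 1 1.

Lemma form_mx2 a b c d : form (mx2 a b c d) = a + p * b + p * c + p ^+ 2 * d.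
Proof. by rewrite /form !mxE. Qed.

Lemma form_tr M : form M^T = form M.
Proof. rewrite /form !mxE; ring. Qed.

(** The left-hand side is q (1, p) P (1, 1 - q)^T, and the initial left turn
    sends (1, 1 - q)^T to (1, p)^T. *)
Lemma form_qmats_false w (P := qmats (false :: w)) :
  q * (1 - q) * (P 0 1 + p * P 1 1) + (q * P 0 0 + P 1 0) = q * form (qmats w).
Proof.
rewrite {}/P qmats_cons (mx2_eta (qmats w)) mx2M form_mx2 !mxE /=; ring: qp.
Qed.

(** For k = 1, the sum over the paths from infinity to the bottom vertex,
    normalized by q ^- r. *)
Lemma transfers_q1_sum w k :
  p ^+ (count negb w).+1 * (q * transfers q 1 w 0 k + 1 * transfers q 1 w 1 k) =
  qmats w 0 k + p * qmats w 1 k.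
Proof.
rewrite transfers_q1 !mxE exprS.
have : p ^+ count negb w * q ^+ count negb w = 1.
  by rewrite -exprMn mulrC qp expr1n.
move: (p ^+ _) (q ^+ _) => x y xy; ring: qp xy.
Qed.

(** For k = 0, the sum over the paths from 0 to the bottom vertex, normalized by
    q ^+ l. *)
Lemma transfers_1p_sum w k :
  q ^+ (count id w).+1 * (1 * transfers 1 p w 0 k + p * transfers 1 p w 1 k) =
  q * qmats w 0 k + qmats w 1 k.
Proof.
rewrite transfers_1p !mxE exprS.
have : q ^+ count id w * p ^+ count id w = 1 by rewrite -exprMn qp expr1n.
move: (q ^+ _) (p ^+ _) => x y xy; ring: qp xy.
Qed.

(** Up to a scalar, the only symmetric solution of the two equations
    X d * T = T * (X d)^T. *)
Definition symm : 'M[R]_2 := mx2 (p - 1) (-1) (-1) (q - 1).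

Lemma qmat_symm d : qmat d * symm = symm * (qmat d)^T.
Proof.
by case: d; rewrite /qmat /symm mx2_tr !mx2M; congr mx2; ring: qp.
Qed.

(** The vector (1, p) is an eigenvector of symm for the eigenvalue - 1. *)
Lemma form_symmr M : form (M * symm) = - form M.
Proof.
rewrite (mx2_eta M) /symm mx2M !form_mx2; ring: qp.
Qed.

Lemma form_symml M : form (symm * M) = - form M.
Proof.
rewrite (mx2_eta M) /symm mx2M !form_mx2; ring: qp.
Qed.

Lemma qmats_symm w : qmats w * symm = symm * (qmats (rev w))^T.
Proof.
elim/last_ind: w => [|w d IH]; first by rewrite /qmats !big_nil trmx1 mul1r mulr1.
rewrite qmats_rcons rev_rcons qmats_cons -mulrA IH.
by rewrite trmx_mul -!mulmxE mulmxA mulmxE qmat_symm -!mulmxE mulmxA.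
Qed.

(** The matrix symm turns a product of the qmat into the transpose of the
    reversed product, and transposition does not change form.  The determinant
    of symm need not be a unit, so symm is moved across the product and then absorbed
    in the eigenvector rather than inverted. *)
Lemma form_rev w : form (qmats (rev w)) = form (qmats w).
Proof.
rewrite -form_tr -[LHS]opprK -form_symml -qmats_symm form_symmr opprK //.
Qed.

Variable f : {rmorphism R -> R}.
Hypotheses (fq : f q = p) (fp : f p = q).

Definition flip : 'M[R]_2 := mx2 0 1 1 0.

Lemma map_qmat d : map_mx f (qmat d) = flip * qmat (~~ d) * flip.
Proof.
have map2 a b c e : map_mx f (mx2 a b c e) = mx2 (f a) (f b) (f c) (f e).
  apply/matrixP => i j; rewrite !mxE.
  by case: i j => [[|[|//]] ?] [[|[|//]] ?].
by case: d => /=; rewrite map2 /flip !mx2M ?fq ?fp rmorph0 rmorph1; congr mx2; ring.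
Qed.

Lemma flipK : flip * flip = 1.
Proof.
rewrite /flip mx2M [RHS]mx2_eta !mxE /=; congr mx2; ring.
Qed.

Lemma map_qmats w : map_mx f (qmats w) = flip * qmats (map negb w) * flip.
Proof.
elim: w => [|d w IH]; first by rewrite /qmats !big_nil mulr1 flipK map_mx1.
rewrite /= !qmats_cons map_mxM IH map_qmat mulmxE !mulrA.
by rewrite -(mulrA _ flip flip) flipK mulr1.
Qed.

(** Exchanging p with q maps (1, p) to (1, q), which is q times the exchange of
    the coordinates of (1, p); the scalar enters squared. *)
Lemma form_flip M : p ^+ 2 * f (form M) = form (flip * map_mx f M * flip).
Proof.
rewrite (mx2_eta (map_mx f M)) /flip !mx2M form_mx2 !mxE /form.
rewrite !rmorphD !rmorphM !fp; ring: qp.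
Qed.

(** The algebraic content of the theorem: form_rev removes the reversal, and
    f, conjugated by flip, exchanges the two letters. *)
Lemma form_dual w :
  q * form (qmats (rev (map negb w))) = f (q * form (qmats w)).
Proof.
rewrite form_rev rmorphM fq.
have -> : qmats (map negb w) = flip * map_mx f (qmats w) * flip.
  by rewrite map_qmats !mulrA flipK mul1r -mulrA flipK mulr1.
by rewrite -form_flip mulrA exprS mulrA qp mul1r expr1.
Qed.

End TransferMatrices.

(** * Words of turns and continued fractions *)

(** The rational reached by a word of turns when x0 remains after the last one:
    in the Stern-Brocot tree, prefixing a right turn is x |-> 1 + x and a left
    turn is x |-> x / (1 + x).  The bottom vertex reached by w is word_val 1 w;
    the degenerate value x0 = 0 gives continued fractions without exception for
    the last partial quotient. *)
Definition word_val (x0 : rat) (w : seq bool) : rat :=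
  foldr (fun d x => if d then 1 + x else x / (1 + x)) x0 w.

Lemma word_val_gt0 x0 w : 0 < x0 -> 0 < word_val x0 w.
Proof.
move=> h; elim: w => //= d w IH; case: d; first by rewrite addr_gt0.
by rewrite divr_gt0 ?addr_gt0.
Qed.

Lemma word_val_rcons x0 w : word_val x0 (rcons w true) = word_val (1 + x0) w.
Proof. by rewrite /word_val foldr_rcons. Qed.

Lemma word_val_cat x0 w w' : word_val x0 (w ++ w') = word_val (word_val x0 w') w.
Proof. by rewrite /word_val foldr_cat. Qed.

Lemma word_val_nseq_true x0 n : word_val x0 (nseq n true) = n%:R + x0.
Proof. by elim: n => [|n IH] /=; rewrite ?add0r // IH addrA nat1r. Qed.

Lemma word_val_nseq_false x0 n : 0 < x0 ->
  word_val x0 (nseq n false) = (n%:R + x0^-1)^-1.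
Proof.
move=> h; elim: n => [|n IH] /=; first by rewrite add0r invrK.
rewrite IH -nat1r.
have : 0 < n%:R + x0^-1 by rewrite ltr_wpDl ?invr_gt0 ?ler0n.
rewrite -addrA; move: (_ + x0^-1) => y y0; field; apply/andP; split; lra.
Qed.

(** The word of a continued fraction, one run of equal turns for each partial
    quotient, starting with the turn d. *)
Fixpoint blocks (d : bool) (s : seq nat) : seq bool :=
  if s is a :: s' then nseq a d ++ blocks (~~ d) s' else [::].

Lemma blocks_rcons d s a :
  blocks d (rcons s a) = blocks d s ++ nseq a (d (+) odd (size s)).
Proof.
elim: s d => [|b s IH] d /=; first by rewrite cats0 addbF.
by rewrite IH catA addNb addbN.
Qed.

Lemma rev_blocks d s : rev (blocks d s) = blocks (~~ d (+) odd (size s)) (rev s).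
Proof.
elim: s d => [|a s IH] d //=.
rewrite rev_cat IH rev_cons blocks_rcons size_rev rev_nseq.
by case: d; case: (odd _).
Qed.

Lemma map_negb_blocks d s : map negb (blocks d s) = blocks (~~ d) s.
Proof. by elim: s d => //= a s IH d; rewrite map_cat map_nseq IH. Qed.

(** A run of a left turns followed by a run of b right turns acts by
    x |-> 1 / (a + 1 / (b + x)), two steps of a continued fraction.  Starting with
    the turn given by the parity makes the last run go right, so that the final
    value 0 never meets a left turn, where it would be absorbed. *)
Lemma word_val_blocks s : all (leq 1) s ->
  word_val 0 (blocks (odd (size s)) s) =
  if odd (size s) then (cf s)^-1 else cf s.
Proof.
elim: s => //= a s IH /andP[a1 s1]; rewrite word_val_cat.
have [o|o] := boolP (odd (size s)); rewrite /= ?(negPf o) ?o /= in IH *.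
  rewrite IH // word_val_nseq_false ?invrK // invr_gt0.
  by rewrite cf_gt0 //; case: (s) o.
by rewrite invrK IH // word_val_nseq_true.
Qed.

(** Even length makes the word start with a left turn and end with a right one.
    The first turn is common to alpha and ir alpha, and the last one brings the
    remaining value 0 to the value 1 of a bottom vertex. *)
Lemma blocks_ends s : all (leq 1) s -> ~~ odd (size s) -> s != [::] ->
  exists w, blocks false s = false :: rcons w true.
Proof.
case: s => // a s; case/lastP: s => // s b.
rewrite /= all_rcons size_rcons /= negbK => /andP[a1 /andP[b1 _]] o _.
rewrite blocks_rcons (negPf o); case: a b a1 b1 => // a [//|b] _ _.
exists (nseq a false ++ blocks true s ++ nseq b true).
rewrite addTb /=; congr (_ :: _); rewrite !rcons_cat; congr (_ ++ (_ ++ _)).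
by elim: b => //= b ->.
Qed.

(** * The shape of the ancestor triangle *)

(** The left parents of w are solutions (p, q) of q P - p Q = 1, where w = P / Q,
    so two of them differ by a multiple of (P, Q); as 0 < q <= Q for both, the
    multiple is zero. *)
Lemma parents_unique y z y' z' w :
  is_parents y z w -> is_parents y' z' w -> y = y' /\ z = z'.
Proof.
have left_den u t : farey_neighbors u t -> 0 < qden u.
  move=> /eqP; have := qden_ge0 u; have := qden_ge0 t.
  case: u => [b|] /=; first by rewrite denq_gt0.
  lia.
move=> /and3P[_ det /eqP e] /and3P[_ det' /eqP e'].
have [en ed] := farey_sumE det; have [en' ed'] := farey_sumE det'.
have yd := left_den _ _ det; have yd' := left_den _ _ det'.
rewrite e in en ed; rewrite e' in en' ed'.
move: det det' (qden_ge0 z) (qden_ge0 z'); rewrite /farey_neighbors.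
move=> /eqP det /eqP det' zd zd'.
suff [eyn eyd] : qnum y = qnum y' /\ qden y = qden y'.
  split; apply: qinfP => //; lia.
move: (qnum y) (qden y) (qnum z) (qden z) (qnum y') (qden y') (qnum z') (qden z')
  (qnum w) (qden w) en ed en' ed' yd yd' det det' zd zd' {e e'}.
move=> p q r s p' q' r' s' P Q -> -> en ed q0 q0' det det' s0 s0'.
have er : r' = p + r - p' by lia.
have es : s' = q + s - q' by lia.
rewrite {}er {}es {en ed} in det' s0' *.
(* Multiply q' - q by the determinant, which is 1. *)
have e : q' - q = (q + s) * (q * (p' - p) - p * (q' - q)).
  have h : (q' - q) * (p + r) = (p' - p) * (q + s) by lia.
  have h1 : q * (p + r) - p * (q + s) = 1 by lia.
  transitivity ((q' - q) * (q * (p + r) - p * (q + s))); first by rewrite h1 mulr1.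
  transitivity (q * ((q' - q) * (p + r)) - (q' - q) * p * (q + s)); first by ring.
  by rewrite h; ring.
have small k : q' - q = (q + s) * k -> k = 0.
  move=> ek; have [k0|k0|//] := ltgtP k 0.
    have : (q + s) * k <= (q + s) * (-1) by apply: ler_wpM2l; lia.
    lia.
  have : (q + s) * 1 <= (q + s) * k by apply: ler_wpM2l; lia.
  lia.
have k0 := small _ e.
rewrite k0 mulr0 in e.
have eq' : q' = q by lia.
split=> //; rewrite eq' subrr mulr0 subr0 in k0.
have : q != 0 by lia.
by move/eqP: k0; rewrite mulf_eq0 => /orP[/eqP -> | /eqP]; [rewrite eqxx | lia].
Qed.

Lemma orphan_zero u : ~~ is_parent u zero.
Proof. by apply/is_parentP => -[z [|] /and3P[]]. Qed.

Lemma orphan_infty u : ~~ is_parent u infty.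
Proof.
have no y z : ~ is_parents y z infty.
  move=> /and3P[_ det /eqP e]; have [_] := farey_sumE det.
  rewrite e /=; move: det; rewrite /farey_neighbors => /eqP.
  have := qden_ge0 y; have := qden_ge0 z => z0 y0 det yz0.
  have qy : qden y = 0 by lia.
  have qz : qden z = 0 by lia.
  by rewrite qy qz mul0r mulr0 in det.
by apply/is_parentP => -[z [|]]; exact: no.
Qed.

Lemma iota_rcons i : iota 0 i.+1 = rcons (iota 0 i) i.
Proof. by rewrite -addn1 iotaD cats1. Qed.

Lemma size_undup_rcons (T : eqType) (s : seq T) x :
  size (undup (rcons s x)) = ((x \notin s) + size (undup s))%N.
Proof.
have /perm_size -> : perm_eq (undup (rcons s x)) (undup (x :: s)).
  by apply: perm_undup => y; rewrite mem_rcons.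
by rewrite /=; case: ifP.
Qed.

Definition turns (a : rat) (i : nat) : seq bool :=
  [seq qlt (mtri a j) a | j <- iota 0 i].

Section Descent.

Variable a : rat.
Hypothesis a0 : 0 < a.

Let n := (ntri a).-1.
Let d i := qlt (mtri a i) a.

Lemma ntriS : ntri a = n.+1. Proof. by []. Qed.

Lemma ytriS i : ytri a i.+1 = if d i then mtri a i else ytri a i.
Proof. by rewrite /ytri /yz iterS /step /d /mtri /ytri /ztri /yz; case: ifP. Qed.

Lemma ztriS i : ztri a i.+1 = if d i then ztri a i else mtri a i.
Proof. by rewrite /ztri /yz iterS /step /d /mtri /ytri /ztri /yz; case: ifP. Qed.

Lemma mtri_parents i : (i <= n)%N -> is_parents (ytri a i) (ztri a i) (mtri a i).
Proof.
move=> le_in; have [|[det y0 z0 _ _] _] := @descent_inv a i a0.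
  by move=> j ji; apply: mtri_neq => //; apply: leq_trans le_in.
rewrite /is_parents det eqxx !andbT /qlt.
have [-> _] := farey_sumE det; rewrite mul0r mulr1.
move: det; rewrite /farey_neighbors => /eqP.
have := qden_ge0 (ztri a i); have := qden_ge0 (ytri a i); nia.
Qed.

(** Heights increase down the triangle, so every new vertex m_i is different
    from all the vertices on the edges above it. *)
Lemma triangle_height i j : (j <= i <= n)%N ->
  (height (ytri a j) < height (mtri a i))%N /\
  (height (ztri a j) < height (mtri a i))%N.
Proof.
move=> /andP[ji]; elim: i ji => [|i IH] ji le_in.
  by move: ji; rewrite leqn0 => /eqP ->; apply/parents_height/mtri_parents.
have [hy hz] := parents_height (mtri_parents le_in).
move: ji; rewrite leq_eqVlt => /orP[/eqP -> //|]; rewrite ltnS => ji.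
have [hy' hz'] := IH ji (ltnW le_in).
have hm : (height (mtri a i) < height (mtri a i.+1))%N.
  by move: hy hz; rewrite ytriS ztriS; case: (d i).
by split; apply: ltn_trans hm.
Qed.

Lemma mtri_new i j : (j <= i <= n)%N ->
  mtri a i != ytri a j /\ mtri a i != ztri a j.
Proof.
by move=> /triangle_height[hy hz]; split; [move: hy|move: hz];
  apply: contraTneq => ->; rewrite ltnn.
Qed.

Lemma ytri_neq_ztri i : (i <= n)%N -> ytri a i != ztri a i.
Proof.
move=> /mtri_parents/and3P[_ det _]; apply: contraTneq det => ->.
by rewrite /farey_neighbors mulrC subrr.
Qed.

(** A path can enter m_i only from the two upper corners of triangle i, because
    these are its only parents. *)
Lemma descent_mtri u i : (i <= n)%N ->
  descent a u (mtri a i) = (u == ytri a i) || (u == ztri a i).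
Proof.
move=> le_in; have par := mtri_parents le_in.
have [ny nz] := @mtri_new i i (introT andP (conj (leqnn i) le_in)).
apply/andP/idP => [[_ /is_parentP[z [|] /(parents_unique par) [ey ez]]]|h].
- by rewrite ey eqxx.
- by rewrite ez eqxx orbT.
split; last first.
  apply/is_parentP; case/orP: h => /eqP ->.
    by exists (ztri a i); left.
  by exists (ytri a i); right.
apply/hasP; exists i; first by rewrite mem_iota ntriS ltnS.
by rewrite !inE eqxx !orbT andbT orbA h andbT; case/orP: h => /eqP ->; rewrite eq_sym.
Qed.

Lemma turnsS i : turns a i.+1 = rcons (turns a i) (d i).
Proof. by rewrite /turns iota_rcons map_rcons. Qed.

(** The left corner changes exactly at the right turns, and then it becomes a
    vertex not seen before. *)
Lemma count_ytri i : (i <= n)%N ->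
  size (undup [seq ytri a j | j <- iota 0 i.+1]) = (count id (turns a i)).+1.
Proof.
elim: i => [//|i IH] le_in; rewrite turnsS -cats1 count_cat [count _ [:: _]]/= addn0.
rewrite iota_rcons map_rcons size_undup_rcons IH ?(ltnW le_in) //.
rewrite addnC addSn; congr (_.+1); congr (_ + _)%N.
rewrite ytriS; case: (d i).
  suff -> : mtri a i \notin [seq ytri a j | j <- iota 0 i.+1] by [].
  apply/mapP => -[j]; rewrite mem_iota /= add0n ltnS => ji.
  by apply/eqP; case: (@mtri_new i j); rewrite // ji ltnW.
suff -> : ytri a i \in [seq ytri a j | j <- iota 0 i.+1] by [].
by apply: map_f; rewrite mem_iota add0n leqnn.
Qed.

Lemma count_ztri i : (i <= n)%N ->
  size (undup [seq ztri a j | j <- iota 0 i.+1]) = (count negb (turns a i)).+1.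
Proof.
elim: i => [//|i IH] le_in; rewrite turnsS -cats1 count_cat [count _ [:: _]]/= addn0.
rewrite iota_rcons map_rcons size_undup_rcons IH ?(ltnW le_in) //.
rewrite addnC addSn; congr (_.+1); congr (_ + _)%N.
rewrite ztriS; case: (d i) => /=; last first.
  suff -> : mtri a i \notin [seq ztri a j | j <- iota 0 i.+1] by [].
  apply/mapP => -[j]; rewrite mem_iota /= add0n ltnS => ji.
  by apply/eqP; case: (@mtri_new i j); rewrite // ji ltnW.
suff -> : ztri a i \in [seq ztri a j | j <- iota 0 i.+1] by [].
by apply: map_f; rewrite mem_iota add0n leqnn.
Qed.

Lemma lE : l a = (count id (turns a n)).+1.
Proof. by rewrite /l /left_side size_rcons ntriS count_ytri. Qed.

Lemma rE : r a = (count negb (turns a n)).+1.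
Proof. by rewrite /r /right_side size_rcons ntriS count_ztri. Qed.

End Descent.

(** * The turns towards the value of a word *)

(** The Mobius coordinate x of a between y and z: the value x = 1 is their Farey
    sum, and x = 0 and x = oo are y and z themselves. *)
Definition at_ratio (a : rat) (y z : qinf) (x : rat) : Prop :=
  a * ((qden y)%:~R + (qden z)%:~R * x) = (qnum y)%:~R + (qnum z)%:~R * x.

(** With m the Farey sum, (a - m) times a positive number is x - 1, by the
    determinant relation between y and z. *)
Lemma farey_sum_compare (a x : rat) y z : farey_neighbors y z -> 0 < x ->
  at_ratio a y z x ->
  qlt (farey_sum y z) a = (1 < x) /\ (farey_sum y z == a :> qinf) = (x == 1).
Proof.
move=> det x0 e; have [mn md] := farey_sumE det.
have detQ : (qnum z)%:~R * (qden y)%:~R - (qnum y)%:~R * (qden z)%:~R = 1 :> rat.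
  move/eqP: det => det; rewrite -!intrM -intrB -[RHS]/(1%:~R) -det.
  by congr (_%:~R); ring.
have y0 : 0 <= (qden y)%:~R :> rat by rewrite ler0z qden_ge0.
have z0 : 0 <= (qden z)%:~R :> rat by rewrite ler0z qden_ge0.
have m0 : 0 < qden (farey_sum y z).
  have := qden_ge0 (farey_sum y z); rewrite le_eqVlt => /orP[/eqP m0|//].
  have := qden_ge0 y; have := qden_ge0 z => z0' y0'.
  have qy : qden y = 0 by lia.
  have qz : qden z = 0 by lia.
  by move: detQ; rewrite qy qz !mulr0 subr0.
have [m em] : exists m : rat, farey_sum y z = m.
  by move: m0; case: (farey_sum y z) => // m _; exists m.
have mE : m * ((qden y)%:~R + (qden z)%:~R) = (qnum y)%:~R + (qnum z)%:~R.
  rewrite -!intrD -mn -md em /= -[X in X * _](divq_num_den m) divfK //.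
  by rewrite intr_eq0 denq_neq0.
have Q0 : 0 < (qden y)%:~R + (qden z)%:~R :> rat by rewrite -intrD -md ltr0z.
rewrite em qlt_rat (_ : (rat_qinf m == a :> qinf) = (m == a)) // => {em mn md m0 det}.
move: e detQ y0 z0 mE Q0; rewrite /at_ratio.
move: ((qden y)%:~R : rat) ((qden z)%:~R : rat) ((qnum y)%:~R : rat)
  ((qnum z)%:~R : rat) => q s p r e det q0 s0 mE Q0.
have D0 : 0 < q + s * x.
  have [q1|q1] := ltP 0 q; first by rewrite ltr_pwDl ?mulr_ge0 ?(ltW x0).
  by rewrite ltr_wpDl ?mulr_gt0 //; lra.
have E : (a - m) * ((q + s) * (q + s * x)) = x - 1.
  have -> : (a - m) * ((q + s) * (q + s * x)) =
    (a * (q + s * x)) * (q + s) - (m * (q + s)) * (q + s * x) by ring.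
  have {}det : r * q = 1 + p * s by lra.
  by rewrite e mE; ring: det.
have DD : 0 < (q + s) * (q + s * x) by rewrite mulr_gt0.
split; first by rewrite -[LHS]subr_gt0 -(pmulr_lgt0 (a - m) DD) E subr_gt0.
rewrite eq_sym -subr_eq0 -[RHS]subr_eq0 -E mulf_eq0 (gt_eqF DD) orbF //.
Qed.

Lemma word_val_cmp1 d w (x := word_val 1 (d :: w)) :
  (1 < x) = d /\ (x == 1) = false.
Proof.
rewrite {}/x /=; have := @word_val_gt0 1 w ltr01; move: (word_val 1 w) => y y0.
case: d; first by split; [lra | rewrite gt_eqF //; lra].
have lt1 : y / (1 + y) < 1 by rewrite ltr_pdivrMr; lra.
by rewrite ltNge (ltW lt1) lt_eqF.
Qed.

(** The invariant of the descent: after i steps, a sits between the current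
    neighbors at the coordinate given by the remaining part of the word. *)
Lemma descent_state w i (a := word_val 1 w) : (i <= size w)%N ->
  farey_neighbors (ytri a i) (ztri a i) /\
  at_ratio a (ytri a i) (ztri a i) (word_val 1 (drop i w)).
Proof.
elim: i => [|i IH] le_i.
  split=> //; rewrite /at_ratio drop0 -/a.
  have [-> -> -> ->] : [/\ qden (ytri a 0) = 1, qden (ztri a 0) = 0,
    qnum (ytri a 0) = 0 & qnum (ztri a 0) = 1] by [].
  by ring.
have [det e] := IH (ltnW le_i).
have x0 := @word_val_gt0 1 (drop i w) ltr01.
have [mE _] := farey_sum_compare det x0 e.
have [mn md] := farey_sumE det; rewrite -/(mtri a i) in mn md mE.
rewrite ytriS ztriS mE; rewrite (drop_nth false le_i) in e *.
have [-> _] := word_val_cmp1 (nth false w i) (drop i.+1 w).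
move: det; rewrite /farey_neighbors => /eqP det.
move: e; rewrite /at_ratio /=.
have := @word_val_gt0 1 (drop i.+1 w) ltr01.
move: (word_val 1 _) => x {}x0; case: (nth false w i); rewrite mn md !intrD.
  have shift (t u : rat) : t + u + u * x = t + u * (1 + x) by ring.
  by move=> e; split; [apply/eqP; rewrite -det; ring | rewrite !shift].
move=> e; split; first by apply/eqP; rewrite -det; ring.
have e' := congr1 ( *%R (1 + x)) e.
have x1 : 1 + x != 0 by rewrite gt_eqF // addr_gt0.
have l1 (t u : rat) : (1 + x) * (t + u * (x / (1 + x))) = t + (t + u) * x by field.
by move: e'; rewrite l1 mulrCA l1.
Qed.

(** The remaining value differs from 1 while the word is not exhausted, and
    equals 1 at its end, so the descent follows w and stops exactly there. *)
Lemma turns_word_val w (a := word_val 1 w) :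
  (ntri a).-1 = size w /\ turns a (ntri a).-1 = w.
Proof.
have a0 : 0 < a by exact: word_val_gt0.
have st i : (i < size w)%N ->
    qlt (mtri a i) a = nth false w i /\ (mtri a i == a :> qinf) = false.
  move=> lt_i; have [det e] := descent_state (ltnW lt_i).
  have x0 := @word_val_gt0 1 (drop i w) ltr01.
  have := farey_sum_compare det x0 e; rewrite (drop_nth false lt_i).
  by have [-> ->] := word_val_cmp1 (nth false w i) (drop i.+1 w).
have ew : mtri a (size w) == a :> qinf.
  have [det e] := descent_state (leqnn (size w)).
  rewrite drop_size in e; have [_ ->] := farey_sum_compare det ltr01 e.
  exact: eqxx.
have en : (ntri a).-1 = size w.
  apply/eqP; rewrite eqn_leq; apply/andP; split; rewrite leqNgt; apply/negP.
    by move=> /(mtri_neq a0); rewrite ew.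
  by move=> /st[_]; rewrite mtri_last // eqxx.
split=> //; apply: (@eq_from_nth _ false); rewrite size_map size_iota ?en // => i lt_i.
by rewrite (nth_map 0%N) ?size_iota // nth_iota //; case: (st i lt_i).
Qed.

(** * Weighted sums over descending paths *)

Section PathSums.

Variables (a : rat) (s : qinf).
Hypotheses (a0 : 0 < a) (s_root : s \in [:: zero; infty]).

Let n := (ntri a).-1.

(** Descending paths from s to an arbitrary vertex x; the induction needs all
    the vertices, while the paths of phi end at a. *)
Definition dpath (x : qinf) (g : seq qinf) : bool :=
  if g is h :: p then [&& h == s, path (descent a) s p & last s p == x]
  else false.

Lemma dpath_rcons x w g : s != x ->
  dpath w (rcons g x) = [&& x == w, dpath (last s g) g & descent a (last s g) x].
Proof.
case: g => [|h p] /= sx; first by rewrite eq_sym (negPf sx) andbF.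
rewrite rcons_path last_rcons; have [->|_] := eqVneq h s; last by rewrite andbF.
rewrite eqxx andbT.
by case: (x == w); rewrite ?andbF //= andbT andbA.
Qed.

Lemma dpath_last x g : dpath x g -> last s g = x.
Proof. by case: g => //= h p /and3P[/eqP -> _ /eqP]. Qed.

Lemma dpathE x g : dpath x g -> exists h, g = rcons h x.
Proof.
move=> h; have := dpath_last h; case: g h => // v p _ /= <-.
by exists (belast v p); rewrite lastI.
Qed.

Lemma dpath_orphan x g : (forall u, ~~ is_parent u x) ->
  dpath x g = (s == x) && (g == [:: s]).
Proof.
move=> orph; case: g => [|h p] /=; first by rewrite andbF.
case/lastP: p => [|p y]; first by rewrite /= andbC eqseq_cons andbT.
rewrite rcons_path last_rcons /descent.
have -> : (h :: rcons p y == [:: s]) = false.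
  by apply/eqP => /(congr1 size) /=; rewrite size_rcons.
rewrite andbF; apply/and3P => -[_ /andP[_ /andP[_ par]] /eqP e].
by move: (orph (last s p)); rewrite -e par.
Qed.

Lemma exit_rcons g x y z : exit_point (rcons g x) y z =
  if (x == y) || (x == z) then Some x else exit_point g y z.
Proof. by rewrite /exit_point filter_rcons; case: ifP => //; rewrite rev_rcons. Qed.

Lemma root_neq_mtri i : (i <= n)%N -> s != mtri a i.
Proof.
move=> le_i; have [] := @mtri_new a a0 i 0; first exact: le_i.
by move: s_root; rewrite !inE => /orP[/eqP -> ny _|/eqP -> _ nz]; rewrite eq_sym.
Qed.

Variables (R : comNzRingType) (t u : R).

(** The contribution of the first i triangles; with two weights, the same
    induction serves for wL and for wR. *)
Definition weight (i : nat) (g : seq qinf) : R :=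
  t ^+ count (fun j => exit_point g (ytri a j) (ztri a j) == Some (ytri a j))
         (iota 0 i) *
  u ^+ count (fun j => exit_point g (ytri a j) (ztri a j) == Some (ztri a j))
         (iota 0 i).

Lemma weightS_ytri i g : (i <= n)%N -> dpath (ytri a i) g ->
  weight i.+1 g = t * weight i g.
Proof.
move=> le_i /dpathE[h ->]; rewrite /weight iota_rcons -!cats1 !count_cat /= !addn0.
rewrite cats1 exit_rcons eqxx /= eqxx.
have -> : (Some (ytri a i) == Some (ztri a i)) = false.
  by apply/eqP => -[]; apply/eqP/(ytri_neq_ztri a0 le_i).
by rewrite addn0 addn1 exprS mulrA.
Qed.

Lemma weightS_ztri i g : (i <= n)%N -> dpath (ztri a i) g ->
  weight i.+1 g = u * weight i g.
Proof.
move=> le_i /dpathE[h ->]; rewrite /weight iota_rcons -!cats1 !count_cat /= !addn0.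
rewrite cats1 exit_rcons eqxx orbT /= eqxx.
have -> : (Some (ztri a i) == Some (ytri a i)) = false.
  by apply/eqP => -[]; apply/eqP; rewrite eq_sym (ytri_neq_ztri a0 le_i).
by rewrite addn0 addn1 exprS mulrCA.
Qed.

(** The new vertex is not on the edge above triangle j for j <= i, so appending
    it changes none of the exit points counted by the weight. *)
Lemma weight_rcons_mtri i g : (i <= n)%N ->
  weight i.+1 (rcons g (mtri a i)) = weight i.+1 g.
Proof.
move=> le_i; have same j : j \in iota 0 i.+1 ->
    exit_point (rcons g (mtri a i)) (ytri a j) (ztri a j) =
    exit_point g (ytri a j) (ztri a j).
  rewrite mem_iota /= add0n ltnS => ji.
  have [|ny nz] := @mtri_new a a0 i j; first by rewrite ji.
  by rewrite exit_rcons (negPf ny) (negPf nz).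
by rewrite /weight; congr (_ ^+ _ * _ ^+ _); apply: eq_in_count => j /same ->.
Qed.

(** The sum over all paths from s to x is c.  A duplicate-free list of the paths
    is asserted to exist because dpath alone does not exhibit them as a finite
    set. *)
Definition path_sum (x : qinf) (i : nat) (c : R) : Prop :=
  exists L, [/\ uniq L, forall g, (g \in L) = dpath x g &
                \sum_(g <- L) weight i g = c].

(** A path ending at the left corner of triangle i leaves the triangle on its
    right. *)
Lemma path_sum_ytri i c : (i <= n)%N ->
  path_sum (ytri a i) i c -> path_sum (ytri a i) i.+1 (t * c).
Proof.
move=> le_i [L [UL mL <-]]; exists L; split=> //.
rewrite mulr_sumr big_seq [RHS]big_seq; apply: eq_bigr => g.
by rewrite mL => /weightS_ytri ->.
Qed.

Lemma path_sum_ztri i c : (i <= n)%N ->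
  path_sum (ztri a i) i c -> path_sum (ztri a i) i.+1 (u * c).
Proof.
move=> le_i [L [UL mL <-]]; exists L; split=> //.
rewrite mulr_sumr big_seq [RHS]big_seq; apply: eq_bigr => g.
by rewrite mL => /weightS_ztri ->.
Qed.

(** A path to m_i is a path to one of the upper corners of triangle i, extended
    by m_i; since the root is not m_i, no path to m_i is trivial. *)
Lemma path_sum_mtri i c c' : (i <= n)%N -> path_sum (ytri a i) i.+1 c ->
  path_sum (ztri a i) i.+1 c' -> path_sum (mtri a i) i.+1 (c + c').
Proof.
move=> le_i [L [UL mL <-]] [L' [UL' mL' <-]].
exists [seq rcons g (mtri a i) | g <- L ++ L']; split.
- rewrite map_inj_uniq; last exact: rcons_injl.
  rewrite cat_uniq UL UL' andbT; apply/hasPn => g; rewrite mL' /= mL => hz.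
  apply: contra (ytri_neq_ztri a0 le_i) => hy.
  by rewrite -(dpath_last hy) -(dpath_last hz).
- have sm := root_neq_mtri le_i.
  move=> g; apply/mapP/idP => [[h]|].
    rewrite mem_cat mL mL' => hh ->; rewrite dpath_rcons // eqxx /=.
    rewrite descent_mtri //; case/orP: hh => hh.
      by rewrite (dpath_last hh) hh eqxx.
    by rewrite (dpath_last hh) hh eqxx orbT.
  move=> hg; have [h e] := dpathE hg; move: hg; rewrite e dpath_rcons //.
  case/and3P=> _ hh; rewrite descent_mtri // => hl; exists h => //.
  by rewrite mem_cat mL mL'; case/orP: hl hh => /eqP -> ->; rewrite ?orbT.
by rewrite big_map big_cat; congr (_ + _); apply: eq_bigr => g _;
  rewrite weight_rcons_mtri.
Qed.

Lemma path_sum_orphan x : (forall v, ~~ is_parent v x) ->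
  path_sum x 0 (s == x)%:R.
Proof.
move=> orph; exists (if s == x then [:: [:: s]] else [::]); split.
- by case: ifP.
- by move=> g; rewrite dpath_orphan //; case: ifP; rewrite ?inE.
case: ifP => _; last by rewrite big_nil.
by rewrite big_seq1 /weight /= mulr1.
Qed.

(** At the top, the pair of sums is the basis vector of the root s, so the sums
    further down are the entries of the column of that root in the product. *)
Lemma path_sum_transfers k i : (s == zero) = (k == 0) -> (i <= n)%N ->
  path_sum (ytri a i) i (transfers t u (turns a i) 0 k) /\
  path_sum (ztri a i) i (transfers t u (turns a i) 1 k).
Proof.
move=> sk; elim: i => [_|i IH lt_i].
  rewrite /transfers big_nil !mxE ![_ == k]eq_sym -sk; split.
    exact: path_sum_orphan orphan_zero.
  have -> : (k == 1) = (s == infty).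
    transitivity (k != 0); first by case: k {sk} => [[|[|//]] ?].
    by rewrite -sk; move: s_root; rewrite !inE => /orP[] /eqP ->.
  exact: path_sum_orphan orphan_infty.
have le_i := ltnW lt_i; have [hy hz] := IH le_i.
have hy' := path_sum_ytri le_i hy; have hz' := path_sum_ztri le_i hz.
have hm := path_sum_mtri le_i hy' hz'.
rewrite turnsS transfers_rcons ytriS ztriS /transfer.
by case: (qlt _ _); rewrite !mx2_mulE mul0r ?add0r ?addr0.
Qed.

(** The last triangle has bottom corner a and makes no turn: it joins the two
    sums at its upper corners. *)
Lemma sum_paths k : (s == zero) = (k == 0) ->
  \sum_(g <- paths s a) t ^+ wR a g * u ^+ wL a g =
  t * transfers t u (turns a n) 0 k + u * transfers t u (turns a n) 1 k.
Proof.
move=> sk; have [hy hz] := path_sum_transfers sk (leqnn n).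
have [L [UL mL <-]] := path_sum_mtri (leqnn n)
  (path_sum_ytri (leqnn n) hy) (path_sum_ztri (leqnn n) hz).
apply: perm_big; apply: uniq_perm => //.
move=> g; rewrite mL mtri_last //; apply/pathsP/idP.
  by move=> [p [-> sp /eqP lp]] /=; rewrite eqxx sp lp.
by case: g => //= h p /and3P[/eqP -> sp /eqP lp]; exists p.
Qed.

End PathSums.

(** * The theorem *)

Lemma q_unit : - A ^+ 4 \is a GRing.unit.
Proof. by rewrite unitrN unitrX // A_unit. Qed.

Lemma bar_q : bar (- A ^+ 4) = (- A ^+ 4)^-1.
Proof. by rewrite rmorphN rmorphXn /= barA invrN exprVn. Qed.

Lemma mul_delta (R : comUnitRingType) (x : R) : x \is a GRing.unit ->
  x ^+ 6 * (- x ^+ 2 - x ^- 2) = - x ^+ 4 * (1 - - x ^+ 4).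
Proof.
move=> xU; have e : x ^+ 6 * x ^- 2 = x ^+ 4.
  by rewrite (_ : 6 = 4 + 2)%N // exprD mulrK // unitrX.
by rewrite mulrBr e; ring.
Qed.

(** A word starting with a left turn belongs to a rational below 1; the initial
    turn is used up in making the form symmetric. *)
Lemma v_phi a w : 0 < a -> turns a (ntri a).-1 = false :: w ->
  v (phi a) = - A ^+ 4 * form (- A ^+ 4)^-1 (qmats (- A ^+ 4) (- A ^+ 4)^-1 w).
Proof.
move=> a0 ta; set q := - A ^+ 4; have qU := q_unit; have qp : q * q^-1 = 1 by rewrite divrr.
set p := q^-1 in qp *.
rewrite /phi /rat_qinf (gt_eqF a0) v_basis lE // rE // ta.
have -> : \sum_(g <- paths infty a) q ^+ wR a g =
    \sum_(g <- paths infty a) q ^+ wR a g * 1 ^+ wL a g.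
  by apply: eq_bigr => g _; rewrite expr1n mulr1.
have -> : \sum_(g <- paths zero a) q ^- wL a g =
    \sum_(g <- paths zero a) 1 ^+ wR a g * p ^+ wL a g.
  by apply: eq_bigr => g _; rewrite expr1n mul1r exprVn.
rewrite (@sum_paths a infty a0 _ _ q 1 1) ?inE ?eqxx ?orbT //.
rewrite (@sum_paths a zero a0 _ _ 1 p 0) ?inE ?eqxx //.
rewrite ta -exprVn -/p (transfers_1p_sum qp) -mulrA [_ * delta]mulrC.
rewrite (mulrCA _ delta) -(mulrA (A ^+ 6)) (transfers_q1_sum qp) mulrA.
rewrite [delta * _]mulrC [A ^+ 6 * delta](mul_delta A_unit).
exact: form_qmats_false qp w.
Qed.

(** The value 0 after a final right turn is the value 1 before it. *)
Lemma turns_cf s : all (leq 1) s -> ~~ odd (size s) -> s != [::] ->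
  exists w, [/\ blocks false s = false :: rcons w true,
    turns (cf s) (ntri (cf s)).-1 = false :: w & 0 < cf s].
Proof.
move=> s1 so s0; have [w ew] := blocks_ends s1 so s0; exists w; split=> //.
  have := word_val_blocks s1; rewrite (negPf so) ew -rcons_cons word_val_rcons addr0.
  by move=> <-; case: (turns_word_val (false :: w)).
exact: cf_gt0.
Qed.

Theorem theorem3p12 (alpha : rat) (halpha : 0 < alpha < 1) :
  v (phi (ir alpha)) = bar (v (phi alpha)).
Proof.
have /and3P[s1 so /eqP e] := even_cfP halpha.
have s0 : even_cf alpha != [::].
  by apply: contraTneq halpha => s0; rewrite -e s0.
rewrite /ir; move: (even_cf alpha) s1 so s0 e => s s1 so s0 <- {alpha halpha}.
have [w [ew tw a0]] := turns_cf s1 so s0.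
have [| | |w' [ew' tw' a0']] := @turns_cf (rev s).
- by rewrite all_rev.
- by rewrite size_rev.
- by rewrite -size_eq0 size_rev size_eq0.
(* Reversing the partial quotients reverses the word and exchanges the turns;
     the two end letters are exchanged with each other. *)
have {ew ew'} ew : w' = rev (map negb w).
  have := rev_blocks true s; rewrite (negPf so) /= ew' -(map_negb_blocks false) ew.
  by rewrite /= map_rcons rev_cons rev_rcons /= => -[/rcons_inj[]].
rewrite ew in tw'; rewrite [in LHS](v_phi a0' tw') [in RHS](v_phi a0 tw).
have bar_qV : bar (- A ^+ 4)^-1 = - A ^+ 4 by rewrite -bar_q barK.
have dual := @form_dual _ _ _ (divrr q_unit) bar bar_q bar_qV w.
exact: dual.
Qed.
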